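(* Let $N\ge1$, $n=2N+1$, let $B=B(x_0,R)\subseteq\mathbb{R}^n$ be the ball with center $x_0$ and radius $R>0$, and let $k$ be a positive constant. If $u$ is a Lipschitz continuous function on $\overline B$ which is a viscosity solution of $$-\operatorname{tr}\big(\widetilde A(Du)D^2u\big)+k=0$$ in $B$, then necessarily $R\le\dfrac1k$.
   Context: Write $p\in\mathbb{R}^n=\mathbb{R}^{2N+1}$ as $p=(p_x,p_y,p_t)$ with $p_x,p_y\in\mathbb{R}^N$, $p_t\in\mathbb{R}$. Let $\sigma(p)=(-p_y,p_x,1)^T$, $A(p)=\sigma(p)\sigma(p)^T$ and $\widetilde A(p)=(1+|p|^2)^{-3/2}A(p)$. Put $F(x,r,p,\Lambda)=-\operatorname{tr}(\widetilde A(p)\Lambda)+k$ for $\Lambda$ symmetric $n\times n$. A continuous function $u$ on $\overline B$ is a viscosity solution of $F=0$ if for every $\phi\in C^2$: at each local maximum point $\bar x\in B$ of $u-\phi$ one has $F(\bar x,u(\bar x),D\phi(\bar x),D^2\phi(\bar x))\le0$ (subsolution), and at each local minimum point $\bar x\in B$ of $u-\phi$ one has $F(\bar x,u(\bar x),D\phi(\bar x),D^2\phi(\bar x))\ge0$ (supersolution). *)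

(* Defs.v *)
From mathcomp Require Import all_boot all_order all_algebra.
From mathcomp Require Import all_classical all_reals all_analysis.
Import Order.TTheory GRing.Theory Num.Theory.
Import numFieldNormedType.Exports.

Set Implicit Arguments.
Unset Strict Implicit.
Unset Printing Implicit Defensive.

Local Open Scope classical_set_scope.
Local Open Scope ring_scope.

(* The library norm on ['rV[R]_n] is the sup norm, so the Euclidean norm and
   balls are defined here; limits and continuity do not depend on the choice. *)
Definition enorm (R : realType) (n : nat) (v : 'rV[R]_n) : R :=
  Num.sqrt (\sum_(i < n) v 0 i ^+ 2).

Definition eball (R : realType) (n : nat) (x0 : 'rV[R]_n) (r : R)
  : set 'rV[R]_n := [set x | enorm (x - x0) < r].

Definition ecball (R : realType) (n : nat) (x0 : 'rV[R]_n) (r : R)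
  : set 'rV[R]_n := [set x | enorm (x - x0) <= r].

Definition lipschitz_in (R : realType) (n : nat) (D : set 'rV[R]_n)
    (u : 'rV[R]_n -> R) : Prop :=
  exists L : R, forall x y, D x -> D y -> `|u x - u y| <= L * enorm (x - y).

Definition partial (R : realType) (n : nat) (i : 'I_n) (f : 'rV[R]_n -> R)
  : 'rV[R]_n -> R := fun x => 'D_(delta_mx 0 i) f x.

Definition grad (R : realType) (n : nat) (f : 'rV[R]_n -> R) (x : 'rV[R]_n)
  : 'rV[R]_n := \row_i partial i f x.

Definition hess (R : realType) (n : nat) (f : 'rV[R]_n -> R) (x : 'rV[R]_n)
  : 'M[R]_n := \matrix_(i, j) partial i (partial j f) x.

Fixpoint classC (R : realType) (n : nat) (m : nat) (f : 'rV[R]_n -> R) : Prop :=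
  continuous f /\
  if m is m'.+1 then
    forall i : 'I_n, (forall x, derivable f x (delta_mx 0 i)) /\
      classC m' (partial i f)
  else True.

(* R^(2N+1) is ['rV[R]_(N + N + 1)], with blocks p = (p_x, p_y, p_t). *)
Definition px (R : realType) (N : nat) (p : 'rV[R]_(N + N + 1)) : 'rV[R]_N :=
  lsubmx (lsubmx p).

Definition py (R : realType) (N : nat) (p : 'rV[R]_(N + N + 1)) : 'rV[R]_N :=
  rsubmx (lsubmx p).

Definition sigma (R : realType) (N : nat) (p : 'rV[R]_(N + N + 1))
  : 'cV[R]_(N + N + 1) :=
  (row_mx (row_mx (- py p) (px p)) (const_mx 1))^T.

Definition levi (R : realType) (N : nat) (p : 'rV[R]_(N + N + 1))
  : 'M[R]_(N + N + 1) := sigma p *m (sigma p)^T.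

Definition levi_tilde (R : realType) (N : nat) (p : 'rV[R]_(N + N + 1))
  : 'M[R]_(N + N + 1) :=
  ((1 + enorm p ^+ 2) `^ (- (3 / 2))) *: levi p.

Definition leviF (R : realType) (N : nat) (k : R) (x : 'rV[R]_(N + N + 1))
    (r : R) (p : 'rV[R]_(N + N + 1)) (L : 'M[R]_(N + N + 1)) : R :=
  - \tr (levi_tilde p *m L) + k.

Section Viscosity.
Variables (R : realType) (n : nat).
Variable F : 'rV[R]_n -> R -> 'rV[R]_n -> 'M[R]_n -> R.

(* [u] is a total function, but since the domain [B] is open, only its values
   in [B] matter for the local extrema below. *)
Definition visc_sub (B : set 'rV[R]_n) (u : 'rV[R]_n -> R) : Prop :=
  forall phi : 'rV[R]_n -> R, classC 2 phi ->
  forall x, B x -> (\forall y \near x, u y - phi y <= u x - phi x) ->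
  F x (u x) (grad phi x) (hess phi x) <= 0.

Definition visc_super (B : set 'rV[R]_n) (u : 'rV[R]_n -> R) : Prop :=
  forall phi : 'rV[R]_n -> R, classC 2 phi ->
  forall x, B x -> (\forall y \near x, u x - phi x <= u y - phi y) ->
  0 <= F x (u x) (grad phi x) (hess phi x).

Definition visc_sol (x0 : 'rV[R]_n) (r : R) (u : 'rV[R]_n -> R) : Prop :=
  [/\ {within ecball x0 r, continuous u},
      visc_sub (eball x0 r) u &
      visc_super (eball x0 r) u].
End Viscosity.

(* Main.v *)
Require Import Defs.
From mathcomp Require Import all_boot all_order all_algebra.
From mathcomp Require Import all_classical all_reals all_analysis.
From mathcomp Require Import ring lra.
Import Order.TTheory GRing.Theory Num.Theory.
Import numFieldNormedType.Exports.
Set Implicit Arguments.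
Unset Strict Implicit.
Unset Printing Implicit Defensive.
Local Open Scope classical_set_scope.
Local Open Scope ring_scope.

(** The lower hemisphere [w x = - sqrt (r^2 - |x - x0|^2)] over the ball of
    radius [r] solves the equation whose constant is [1 / r]: writing
    [p = Dw] and [S = - w], one has [D^2 w = (I + p p^T) / S] and
    [1 + |p|^2 = (r / S)^2], while [sigma(p)] satisfies
    [|sigma(p)|^2 = 1 + |p_x|^2 + |p_y|^2] and [p . sigma(p) = p_t]; hence
    [tr (A(p) D^2 w) = (1 + |p|^2) / S] and, after normalization,
    [tr (levi_tilde(p) D^2 w) = 1 / r].

    The slope of [w] is infinite at the boundary of the ball whereas [u] is
    Lipschitz, so [u - w] attains its maximum over the closed ball at an
    interior point [z] ([hemisphere_max_interior]).  The subsolution property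
    tested with [w] at [z] would say [k <= 1 / r].

    As [w] is not a C^2 function on the whole space, it is replaced by a
    quartic polynomial, quadratic in [|x - x0|^2], which touches [w] from above
    at [z] with the same gradient.  Taking its second-order coefficient to be
    [m > 1] times the Taylor coefficient of [w] makes it stay above [w] near
    [z] ([hemisphere_quartic_le]); its Hessian at [z] is
    [(I + m p p^T) / S], and [tr_levi_tilde_le] then bounds [k] by [m / r].
    Letting [m] decrease to [1] concludes. *)

(** * Squared Euclidean distance and balls *)

Definition sqdist (R : realType) (n : nat) (x0 x : 'rV[R]_n) : R :=
  \sum_(i < n) (x 0 i - x0 0 i) ^+ 2.

Lemma sqdist_ge0 (R : realType) (n : nat) (x0 x : 'rV[R]_n) :
  0 <= sqdist x0 x.
Proof. by apply: sumr_ge0 => i _; exact: sqr_ge0. Qed.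

Lemma enormBE (R : realType) (n : nat) (x0 x : 'rV[R]_n) :
  enorm (x - x0) = Num.sqrt (sqdist x0 x).
Proof.
by congr Num.sqrt; apply: eq_bigr => i _; rewrite !mxE.
Qed.

Lemma ecballE (R : realType) (n : nat) (x0 : 'rV[R]_n) (r : R) (r0 : 0 <= r) :
  ecball x0 r = [set x | sqdist x0 x <= r ^+ 2].
Proof.
apply/seteqP; split=> x /=; rewrite /ecball /= enormBE => h.
  by rewrite -(sqr_sqrtr (sqdist_ge0 x0 x)) ler_sqr ?nnegrE ?sqrtr_ge0.
by rewrite -(ger0_norm r0) -sqrtr_sqr ler_sqrt ?sqr_ge0.
Qed.

Lemma eballE (R : realType) (n : nat) (x0 : 'rV[R]_n) (r : R) (r0 : 0 < r) :
  eball x0 r = [set x | sqdist x0 x < r ^+ 2].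
Proof.
apply/seteqP; split=> x /=; rewrite /eball /= enormBE => h.
  by rewrite -(sqr_sqrtr (sqdist_ge0 x0 x)) ltr_sqr ?nnegrE ?sqrtr_ge0 ?ltW.
by rewrite -(gtr0_norm r0) -sqrtr_sqr ltr_sqrt ?exprn_gt0.
Qed.

Lemma sqdist_fctE (R : realType) (n : nat) (x0 : 'rV[R]_n) :
  sqdist x0 = \sum_(i < n) ((fun y : 'rV[R]_n => y 0 i) - cst (x0 0 i)) ^+ 2.
Proof. by apply/funext => y; rewrite fct_sumE. Qed.

Lemma coordB_continuous (R : realType) (n : nat) (i : 'I_n) (c : R) :
  continuous (fun x : 'rV[R]_n => x 0 i - c).
Proof.
move=> x; have h := @coord_continuous R 1 n 0 i x.
exact: (cvgB h (cvg_cst c)).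
Qed.

Lemma sqdist_continuous (R : realType) (n : nat) (x0 : 'rV[R]_n) :
  continuous (sqdist x0).
Proof.
rewrite sqdist_fctE.
apply: (big_ind (fun f : 'rV[R]_n -> R => continuous f)).
- by move=> x; exact: (@cst_continuous _ _ (0 : R)).
- by move=> f g cf cg x; exact: cvgD (cf x) (cg x).
move=> i _ x; rewrite expr2.
have c := @coordB_continuous R n i (x0 0 i) x.
exact: (cvgM c c).
Qed.

Lemma ecball_compact (R : realType) (n : nat) (x0 : 'rV[R]_n) (r : R)
  (r0 : 0 <= r) : compact (ecball x0 r).
Proof.
rewrite ecballE//; apply: bounded_closed_compact; last first.
  apply: (@preimage_closed _ _ (sqdist x0) [set t | t <= r ^+ 2]).
    by move=> x _; exact: sqdist_continuous.
  exact: closed_le.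
exists (`|x0| + r); split; first exact: num_real.
move=> M hM x /= hx; apply: le_trans (ltW hM).
rewrite -[x](subrK x0) addrC; apply: le_trans (ler_normD _ _) _.
rewrite lerD2l [leLHS]/Num.Def.normr /= mx_normrE.
apply/bigmax_leP; split=> //=.
move=> [i j] _ /=; rewrite ord1 !mxE.
rewrite -(ger0_norm r0) -ler_sqr ?nnegrE ?normr_ge0// !real_normK ?num_real//.
apply: le_trans hx; rewrite /sqdist (bigD1 j)//= lerDl.
by apply: sumr_ge0 => l _; exact: sqr_ge0.
Qed.

(** * Derivatives of radial quartic polynomials *)

Lemma coord_is_derive (R : realType) (n : nat) (x v : 'rV[R]_n) (i : 'I_n) :
  is_derive x v (fun y : 'rV[R]_n => y 0 i) (v 0 i).
Proof.
apply: DeriveDef; first exact/diff_derivable/differentiable_coord.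
have := derive_mx (@derivable_id R 'rV[R]_n x v).
by rewrite derive_id => /matrixP/(_ 0 i) ->; rewrite mxE.
Qed.

Lemma sqdist_is_derive (R : realType) (n : nat) (x0 x v : 'rV[R]_n) :
  is_derive x v (sqdist x0) (2 * \sum_(i < n) (x 0 i - x0 0 i) * v 0 i).
Proof.
rewrite sqdist_fctE.
have cd := @coord_is_derive R n x v.
apply: is_derive_eq; rewrite mulr_sumr; apply: eq_bigr => i _.
by rewrite /GRing.scale /= !fctE expr1 subr0 mulrA.
Qed.

Lemma sum_delta (R : realType) (n : nat) (w : 'I_n -> R) (j : 'I_n) :
  \sum_(i < n) w i * (delta_mx 0 j : 'rV[R]_n) 0 i = w j.
Proof.
rewrite (bigD1 j)//= big1 ?addr0 ?mxE ?eqxx ?mulr1// => i ij.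
by rewrite mxE eqxx /= (negbTE ij) mulr0.
Qed.

(** Centred at the value [t] of the squared distance, so that [a], [b] and [c]
    are its Taylor coefficients in that variable on the sphere where the contact
    with the hemisphere takes place. *)
Definition radial_quartic (R : realType) (n : nat) (x0 : 'rV[R]_n)
    (t a b c : R) (x : 'rV[R]_n) : R :=
  a + b * (sqdist x0 x - t) + c * (sqdist x0 x - t) ^+ 2.

Section RadialQuartic.
Variables (R : realType) (n : nat) (x0 : 'rV[R]_n) (t a b c : R).

Let phi := radial_quartic x0 t a b c.
Let slope (x : 'rV[R]_n) := 2 * (b + 2 * c * (sqdist x0 x - t)).

Lemma radial_quartic_is_derive (x v : 'rV[R]_n) :
  is_derive x v phi (slope x * \sum_(i < n) (x 0 i - x0 0 i) * v 0 i).
Proof.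
have -> : phi = cst a + b \*: (sqdist x0 - cst t)
                + c \*: (sqdist x0 - cst t) ^+ 2 by apply/funext.
have dq := sqdist_is_derive x0 x v.
apply: is_derive_eq; rewrite /slope /GRing.scale /= !fctE.
rewrite !subr0 add0r expr1.
set S := \sum_(i < n) _; set q := sqdist x0 x.
(* The derivation rules build the goal with the operations of [R] seen as a
   normed module over itself; [ring] needs those of the ring [R]. *)
suff : b * (2 * S) + c * (2 * (q - t) * (2 * S))
       = 2 * (b + 2 * c * (q - t)) * S by [].
by ring.
Qed.

Lemma partial_radial_quartic (i : 'I_n) :
  partial i phi = fun x => slope x * (x 0 i - x0 0 i).
Proof.
apply/funext => x; have d := radial_quartic_is_derive x (delta_mx 0 i).
by rewrite /partial derive_val sum_delta.
Qed.

Lemma partial_radial_quartic_is_derive (i : 'I_n) (x v : 'rV[R]_n) :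
  is_derive x v (partial i phi)
    (8 * c * (\sum_(l < n) (x 0 l - x0 0 l) * v 0 l) * (x 0 i - x0 0 i)
     + slope x * v 0 i).
Proof.
have -> : partial i phi =
    (cst (2 * b) + (4 * c) \*: (sqdist x0 - cst t)) *
    ((fun y : 'rV[R]_n => y 0 i) - cst (x0 0 i)).
  rewrite partial_radial_quartic; apply/funext => y.
  suff : forall q z : R, 2 * (b + 2 * c * (q - t)) * z =
                         (2 * b + 4 * c * (q - t)) * z by apply.
  by move=> q z; ring.
have dq := sqdist_is_derive x0 x v.
have dc := coord_is_derive x v i.
apply: is_derive_eq; rewrite /slope /GRing.scale /= !fctE /=.
rewrite /GRing.scale /= !subr0 add0r; set S := \sum_(i < n) _.
suff : forall q y w : R,
    (2 * b + 4 * c * (q - t)) * w + y * (4 * c * (2 * S)) =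
    8 * c * S * y + 2 * (b + 2 * c * (q - t)) * w by apply.
by move=> q y w; ring.
Qed.

Lemma partial2_radial_quartic (i j : 'I_n) :
  partial i (partial j phi) = fun x =>
    8 * c * (x 0 i - x0 0 i) * (x 0 j - x0 0 j) + slope x * (i == j)%:R.
Proof.
apply/funext => x.
have d := partial_radial_quartic_is_derive j x (delta_mx 0 i).
by rewrite [LHS]derive_val sum_delta mxE eqxx /= eq_sym.
Qed.

Let continuousM (f g : 'rV[R]_n -> R) : continuous f -> continuous g ->
  continuous (fun x => f x * g x).
Proof. by move=> cf cg x; exact: cvgM (cf x) (cg x). Qed.

Let continuousD (f g : 'rV[R]_n -> R) : continuous f -> continuous g ->
  continuous (fun x => f x + g x).
Proof. by move=> cf cg x; exact: cvgD (cf x) (cg x). Qed.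

Let continuousC (k : R) : continuous (fun _ : 'rV[R]_n => k).
Proof. exact: cst_continuous. Qed.

Let gap_continuous : continuous (fun x => sqdist x0 x - t).
Proof. exact: continuousD (@sqdist_continuous R n x0) (@continuousC (- t)). Qed.

Let slope_continuous : continuous slope.
Proof.
apply: continuousM; first exact: continuousC.
apply: continuousD; first exact: continuousC.
exact: continuousM (@continuousC (2 * c)) gap_continuous.
Qed.

Lemma radial_quartic_classC2 : classC 2 phi.
Proof.
split.
  apply: continuousD.
    apply: continuousD; first exact: continuousC.
    exact: continuousM (@continuousC b) gap_continuous.
  apply: continuousM; first exact: continuousC.
  exact: continuousM gap_continuous gap_continuous.
move=> i; split=> [x|].
  by have [] := radial_quartic_is_derive x (delta_mx 0 i).
split.
  rewrite partial_radial_quartic.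
  exact: continuousM slope_continuous (@coordB_continuous R n i (x0 0 i)).
move=> j; split=> [x|].
  by have [] := partial_radial_quartic_is_derive i x (delta_mx 0 j).
split=> //; rewrite partial2_radial_quartic.
have cB l := @coordB_continuous R n l (x0 0 l).
apply: continuousD.
  apply: continuousM (cB i).
  exact: continuousM (@continuousC (8 * c)) (cB j).
exact: continuousM slope_continuous (@continuousC (j == i)%:R).
Qed.

End RadialQuartic.

(** * The hemisphere and its contact with the graph *)

(** With [S] and [s] the heights of the hemisphere at the contact point and at
    a nearby point, [S^2 - s^2] is the increment of the squared distance and
    [(2 S)^-1] the derivative of the hemisphere with respect to it.  The
    difference of the two sides factors through [(S - s)^2], and the hypothesis
    holds for [s] close to [S] as soon as [c] exceeds the Taylor coefficient
    [1 / (8 S^3)]. *)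
Lemma hemisphere_quartic_le (R : realType) (S s c : R) : 0 < S ->
  1 <= 2 * S * c * (S + s) ^+ 2 ->
  - s <= - S + (2 * S)^-1 * (S ^+ 2 - s ^+ 2) + c * (S ^+ 2 - s ^+ 2) ^+ 2.
Proof.
move=> S0 h; rewrite -(ler_pM2l (_ : 0 < 2 * S)); last by rewrite mulr_gt0.
rewrite -subr_ge0; set d := (X in 0 <= X).
have -> : d = (S - s) ^+ 2 * (2 * S * c * (S + s) ^+ 2 - 1).
  by rewrite /d; field; rewrite gt_eqF.
by rewrite mulr_ge0 ?sqr_ge0// subr_ge0.
Qed.

Lemma hemisphere_continuous (R : realType) (n : nat) (x0 : 'rV[R]_n) (r : R) :
  continuous (fun x => Num.sqrt (r ^+ 2 - sqdist x0 x)).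
Proof.
move=> x.
apply: (@continuous_comp _ _ _ (fun y => r ^+ 2 - sqdist x0 y) Num.sqrt).
  exact: (cvgB (cvg_cst (r ^+ 2)) (@sqdist_continuous R n x0 x)).
exact: sqrt_continuous.
Qed.

(** At a boundary maximum [z], moving inwards by a fraction [d] of the radius
    raises the hemisphere height from [0] to at least [r * sqrt d] but lowers
    [u] by at most [L * d * r], which is less once [L^2 * d < 1]. *)
Lemma hemisphere_max_interior (R : realType) (n : nat) (x0 : 'rV[R]_n) (r : R)
    (u : 'rV[R]_n -> R) : 0 < r ->
  {within ecball x0 r, continuous u} -> lipschitz_in (ecball x0 r) u ->
  exists2 z, sqdist x0 z < r ^+ 2 & forall x, sqdist x0 x <= r ^+ 2 ->
    u x + Num.sqrt (r ^+ 2 - sqdist x0 x) <=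
    u z + Num.sqrt (r ^+ 2 - sqdist x0 z).
Proof.
move=> r0 cu [L lipu]; have r0' := ltW r0.
have inB x : (x \in ecball x0 r) = (sqdist x0 x <= r ^+ 2).
  by rewrite ecballE//; apply/idP/idP; rewrite inE.
have [||z] := @EVT_max_rV R n
    (fun x => u x + Num.sqrt (r ^+ 2 - sqdist x0 x)) _ _
    (@ecball_compact R n x0 r r0').
- exists x0; rewrite ecballE//= /sqdist big1 ?sqr_ge0// => i _.
  by rewrite subrr expr0n.
- move=> x; apply: cvgD; first exact: cu.
  exact: continuous_subspaceT (@hemisphere_continuous R n x0 r) x.
rewrite inB => zB max; exists z; last first.
  by move=> x xB; apply: max; rewrite inB.
rewrite lt_neqAle zB andbT; apply/eqP => zr.
(* Any [d] in ]0, 1[ with [L ^+ 2 * d < 1] would do. *)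
pose d := (2 * (1 + L ^+ 2))^-1; pose x := z - d *: (z - x0).
have L0 := sqr_ge0 L.
have d0 : 0 < d by rewrite invr_gt0; nra.
have dE : d * (2 * (1 + L ^+ 2)) = 1 by rewrite mulVf// gt_eqF; nra.
have xE : sqdist x0 x = (1 - d) ^+ 2 * r ^+ 2.
  rewrite -zr /sqdist mulr_sumr; apply: eq_bigr => i _.
  by rewrite !mxE; ring.
have xB : sqdist x0 x <= r ^+ 2 by rewrite xE; nra.
have zx : enorm (z - x) = d * r.
  rewrite enormBE; have -> : sqdist x z = (d * r) ^+ 2.
    rewrite exprMn -zr /sqdist mulr_sumr; apply: eq_bigr => i _.
    by rewrite !mxE; ring.
  by rewrite sqrtr_sqr ger0_norm// mulr_ge0// ltW.
have uzx : u z - u x <= L * (d * r).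
  rewrite -zx; apply: le_trans (ler_norm _) _.
  by apply: lipu; rewrite ecballE.
have := max x; rewrite inB => /(_ xB).
rewrite zr subrr sqrtr0 addr0 => mx.
have h : Num.sqrt (r ^+ 2 - sqdist x0 x) <= L * (d * r) by lra.
have h2 : r ^+ 2 - sqdist x0 x <= (L * (d * r)) ^+ 2.
  rewrite -(sqr_sqrtr (_ : 0 <= r ^+ 2 - sqdist x0 x)) ?subr_ge0//.
  by rewrite ler_sqr ?nnegrE ?sqrtr_ge0// (le_trans (sqrtr_ge0 _) h).
have {h2} : 0 <= (d * r ^+ 2) * (L ^+ 2 * d - (2 - d)).
  by move: h2; rewrite xE -subr_ge0 => h2; rewrite (le_trans h2)//; lra.
rewrite pmulr_rge0; last by rewrite mulr_gt0// exprn_gt0.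
nra.
Qed.

(** * The Levi operator on Hessians of radial functions *)

Section LeviTrace.
Variables (R : realType) (N : nat) (p : 'rV[R]_(N + N + 1)).

Let ptE : p = row_mx (row_mx (px p) (py p)) (rsubmx p).
Proof. by rewrite /px /py !hsubmxK. Qed.

Let mul_tr_sym (u v : 'rV[R]_N) : u *m v^T = v *m u^T.
Proof.
apply/matrixP => i j; rewrite !mxE !ord1.
by apply: eq_bigr => l _; rewrite !mxE mulrC.
Qed.

Let addmx00 (A B : 'M[R]_1) : (A + B) 0 0 = A 0 0 + B 0 0.
Proof. by rewrite mxE. Qed.

Lemma row_mul_trE n (v : 'rV[R]_n) : (v *m v^T) 0 0 = enorm v ^+ 2.
Proof.
rewrite /enorm sqr_sqrtr; last by apply: sumr_ge0 => i _; exact: sqr_ge0.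
by rewrite mxE; apply: eq_bigr => i _; rewrite mxE expr2.
Qed.

Lemma enorm_sqr_blocks :
  enorm p ^+ 2 = enorm (px p) ^+ 2 + enorm (py p) ^+ 2 + rsubmx p 0 0 ^+ 2.
Proof.
rewrite -!row_mul_trE {1 2}ptE !tr_row_mx !mul_row_col !addmx00.
by congr (_ + _); rewrite mxE big_ord1 [X in _ * X]mxE expr2.
Qed.

Lemma sigma_sqr :
  ((sigma p)^T *m sigma p) 0 0 = 1 + enorm (px p) ^+ 2 + enorm (py p) ^+ 2.
Proof.
rewrite /sigma trmxK !tr_row_mx !mul_row_col !addmx00.
rewrite linearN /= mulmxN mulNmx opprK.
rewrite (row_mul_trE (px p)) (row_mul_trE (py p)) mxE big_ord1 !mxE mulr1.
by ring.
Qed.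

(** The horizontal part of [sigma p] is [p] rotated by a right angle in each
    plane [(x_i, y_i)], hence only the vertical components contribute. *)
Lemma mul_sigma : (p *m sigma p) 0 0 = rsubmx p 0 0.
Proof.
rewrite {1}ptE /sigma !tr_row_mx !mul_row_col linearN /= mulmxN.
rewrite mul_tr_sym addNr add0r.
by rewrite mxE big_ord1 [X in _ * X]mxE [X in _ * X]mxE mulr1.
Qed.

(** The unnormalized trace is [1 + |p_x|^2 + |p_y|^2 + m p_t^2], which is at
    most [m (1 + |p|^2)] with equality for [m = 1]; the factor
    [(1 + |p|^2)^(-3/2)] leaves [(1 + |p|^2)^(-1/2)]. *)
Lemma tr_levi_tilde_le (s m : R) : 0 <= s -> 1 <= m ->
  \tr (levi_tilde p *m (s *: (1%:M + m *: (p^T *m p)))) <=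
  s * m / Num.sqrt (1 + enorm p ^+ 2).
Proof.
move=> s0 m1; set w := 1 + enorm p ^+ 2.
have w0 : 0 < w by rewrite ltr_wpDr// sqr_ge0.
have trE : \tr (levi p *m (1%:M + m *: (p^T *m p))) =
    1 + enorm (px p) ^+ 2 + enorm (py p) ^+ 2 + m * rsubmx p 0 0 ^+ 2.
  rewrite /levi mulmxDr mulmx1 mxtraceD -scalemxAr mxtraceZ.
  congr (_ + _ * _); first by rewrite mxtrace_mulC /mxtrace big_ord1 sigma_sqr.
  rewrite -mulmxA mxtrace_mulC.
  have -> : (sigma p)^T *m (p^T *m p) *m sigma p =
            (p *m sigma p)^T *m (p *m sigma p) by rewrite trmx_mul !mulmxA.
  by rewrite /mxtrace big_ord1 mxE big_ord1 [X in X * _]mxE mul_sigma expr2.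
rewrite /levi_tilde -scalemxAl -scalemxAr !mxtraceZ trE.
have powE : w `^ (- (3 / 2)) = w^-1 / Num.sqrt w.
  have -> : - (3 / 2) = - 1 + - 2^-1 :> R by lra.
  rewrite powRD ?(gt_eqF w0) ?implybT// !powRN powRr1 ?ltW//.
  by rewrite -powR12_sqrt ?ltW.
rewrite -/w powE.
have q0 : 0 < Num.sqrt w by rewrite sqrtr_gt0.
set T := (X in _ * (_ * X)).
have Tw : T <= m * w.
  rewrite /T /w enorm_sqr_blocks.
  have := sqr_ge0 (enorm (px p)); have := sqr_ge0 (enorm (py p)); nra.
have -> : w^-1 / Num.sqrt w * (s * T) = s / Num.sqrt w * (T / w) by ring.
rewrite [leRHS]mulrAC; apply: ler_wpM2l; first by rewrite divr_ge0// ltW.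
by rewrite ler_pdivrMr.
Qed.
End LeviTrace.

(** * The bound on the radius *)

Theorem proposition6p6 (R : realType) (N : nat) (hN : (1 <= N)%N)
    (x0 : 'rV[R]_(N + N + 1)) (r : R) (hr : 0 < r) (k : R) (hk : 0 < k)
    (u : 'rV[R]_(N + N + 1) -> R)
    (hlip : lipschitz_in (ecball x0 r) u)
    (hvisc : visc_sol (leviF k) x0 r u) :
  r <= 1 / k.
Proof.
have [cu subu _] := hvisc.
have [z zB zmax] := hemisphere_max_interior hr cu hlip.
rewrite ler_pdivlMr//; apply/ler_addgt0Pr => e e0; set m := 1 + e.
have m1 : 1 < m by rewrite ltrDl.
pose s x := Num.sqrt (r ^+ 2 - sqdist x0 x).
have sE x : sqdist x0 x <= r ^+ 2 -> s x ^+ 2 = r ^+ 2 - sqdist x0 x.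
  by move=> xB; rewrite sqr_sqrtr// subr_ge0.
set S := s z; have S0 : 0 < S by rewrite sqrtr_gt0 subr_gt0.
have SE : S ^+ 2 = r ^+ 2 - sqdist x0 z by rewrite sE// ltW.
(* [1 / (8 S^3)] is half the second derivative, at [t = |z - x0|^2], of the
   hemisphere [- sqrt (r^2 - t)]. *)
pose c := m / (8 * S ^+ 3).
pose phi := radial_quartic x0 (sqdist x0 z) 0 (2 * S)^-1 c.
have zphi : phi z = 0 by rewrite /phi /radial_quartic subrr; ring.
have touch : \forall y \near z, u y - phi y <= u z - phi z.
  have Bnear : \forall y \near z, sqdist x0 y < r ^+ 2.
    exact: (cvgr_lt _ (@sqdist_continuous R _ x0 z) _ zB).
  (* This implies [4 S^2 < m (S + s y)^2], which is the hypothesis of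
     [hemisphere_quartic_le] for this [c]; it holds at [y = z] as [m > 1]. *)
  have snear : \forall y \near z, S * (2 / Num.sqrt m - 1) < s y.
    apply: (cvgr_gt _ (@hemisphere_continuous R _ x0 r z)).
    rewrite gtr_pMr// ltrBlDr -[ltRHS]/2 ltr_pdivrMr ?sqrtr_gt0; last by lra.
    by rewrite ltr_pMr// -sqrtr1 ltr_sqrt//; lra.
  near=> y.
  have yB : sqdist x0 y <= r ^+ 2 by apply: ltW; near: y.
  have ys : S * (2 / Num.sqrt m - 1) < s y by near: y.
  have := zmax y yB; rewrite -/(s y) -/(s z) -/S zphi subr0 => uy.
  have hq : 1 <= 2 * S * c * (S + s y) ^+ 2.
    have q0 : 0 < Num.sqrt m by rewrite sqrtr_gt0; lra.
    have h1 : 2 * S / Num.sqrt m <= S + s y.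
      have -> : 2 * S / Num.sqrt m = S + S * (2 / Num.sqrt m - 1) by ring.
      by rewrite lerD2l ltW.
    have -> : 2 * S * c = (2 * S / Num.sqrt m) ^- 2.
      rewrite exprMn exprVn sqr_sqrtr; last by lra.
      by rewrite /c; field; apply/andP; split; rewrite gt_eqF//; lra.
    have hpos : 0 < 2 * S / Num.sqrt m by rewrite divr_gt0// mulr_gt0.
    rewrite mulrC ler_pdivlMr ?exprn_gt0// mul1r ler_sqr ?nnegrE ?(ltW hpos)//.
    exact: le_trans (ltW hpos) h1.
  have := hemisphere_quartic_le S0 hq.
  have -> : S ^+ 2 - s y ^+ 2 = sqdist x0 y - sqdist x0 z.
    by rewrite SE sE//; ring.
  rewrite /phi /radial_quartic add0r; lra.
have zin : eball x0 r z by rewrite eballE.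
have := subu phi (radial_quartic_classC2 _ _ _ _ _) z zin touch.
have gradE : grad phi z = S^-1 *: (z - x0).
  apply/rowP => i; rewrite mxE partial_radial_quartic !mxE subrr.
  by field; rewrite gt_eqF.
set p := grad phi z in gradE *.
have hessE : hess phi z = S^-1 *: (1%:M + m *: (p^T *m p)).
  apply/matrixP => i j; rewrite mxE partial2_radial_quartic gradE !mxE big_ord1.
  by rewrite !mxE subrr /c; field; rewrite gt_eqF.
have pE : 1 + enorm p ^+ 2 = (r / S) ^+ 2.
  have -> : enorm p ^+ 2 = S^-1 ^+ 2 * sqdist x0 z.
    rewrite -row_mul_trE mxE gradE /sqdist mulr_sumr; apply: eq_bigr => i _.
    by rewrite !mxE; ring.
  have -> : sqdist x0 z = r ^+ 2 - S ^+ 2 by rewrite SE; ring.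
  by field; rewrite gt_eqF.
rewrite /leviF hessE => hF.
have := @tr_levi_tilde_le R N p S^-1 m.
rewrite invr_ge0 => /(_ (ltW S0) (ltW m1)).
rewrite pE sqrtr_sqr gtr0_norm ?divr_gt0// => hT.
have km : k <= m / r.
  have -> : m / r = S^-1 * m / (r / S) by field; rewrite !gt_eqF.
  lra.
by rewrite mulrC -ler_pdivlMr.
Unshelve. all: by end_near.
Qed.
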